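(* Let $\Omega\subset\mathbb{R}^d$ be compact and let $\Phi\in C(\Omega\times\Omega)$ be a symmetric positive definite kernel whose reproducing kernel Hilbert space $\mathcal{N}_\Phi(\Omega)$ is dense in $L_2(\Omega)$. Let $\omega_{\tau_1},\dots,\omega_{\tau_n}\subseteq\Omega$ be Lebesgue measurable sets of positive measure whose characteristic functions $\chi_{\omega_{\tau_1}},\dots,\chi_{\omega_{\tau_n}}$ are linearly independent in $L_2(\Omega)$. Then the matrix $\mathbf{K}\in\mathbb{R}^{n\times n}$ with entries \[\mathbf{K}_{i,j}=\frac{1}{|\omega_{\tau_i}|}\frac{1}{|\omega_{\tau_j}|}\int_{\omega_{\tau_i}}\int_{\omega_{\tau_j}}\Phi(x,y)\,\mathrm{d}x\,\mathrm{d}y\] is symmetric and positive definite, and in particular invertible.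
   Context: $|\omega|$ denotes Lebesgue measure and $\chi_\omega$ the indicator function of $\omega$. A kernel $\Phi$ is positive definite if for all distinct $x_1,\dots,x_m$ the matrix $(\Phi(x_k,x_\ell))_{k,\ell}$ is positive definite. *)

(* Defs.v *)
From HB Require Import structures.
From mathcomp Require Import all_boot all_order all_algebra.
From mathcomp Require Import all_classical all_reals all_analysis.
Set Implicit Arguments. Unset Strict Implicit. Unset Printing Implicit Defensive.
Import Order.TTheory GRing.Theory Num.Theory.
Import numFieldNormedType.Exports.
Local Open Scope classical_set_scope.
Local Open Scope ring_scope.

(* Points of R^d are represented as d.-tuples of reals; d.-tuple R carries the
   product (= Borel) sigma-algebra of mathcomp-analysis. *)

(* Transport to row vectors, which carry the usual topology of R^d. *)
Definition to_rV (R : realType) (d : nat) (x : d.-tuple R) : 'rV[R]_d :=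
  \row_i tnth x i.
Definition of_rV (R : realType) (d : nat) (v : 'rV[R]_d) : d.-tuple R :=
  [tuple v ord0 i | i < d].

(* mu is the Lebesgue measure on the Borel sets of R^d: it gives every closed
   box its volume (this determines a measure on the Borel sets uniquely). *)
Definition is_box_volume (R : realType) (d : nat)
    (mu : {measure set (d.-tuple R) -> \bar R}) : Prop :=
  forall a b : d.-tuple R, (forall i, tnth a i <= tnth b i) ->
    mu [set x | forall i, tnth a i <= tnth x i <= tnth b i] =
    (\prod_(i < d) (tnth b i - tnth a i))%:E.

(* The Lebesgue measure = completion of mu (Caratheodory extension);
   its measurable sets are the Lebesgue measurable sets. *)
Definition LebT (R : realType) (d : nat)
    (mu : {measure set (d.-tuple R) -> \bar R}) :=
  caratheodory_type (mu^*)%mu.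
Definition leb (R : realType) (d : nat)
    (mu : {measure set (d.-tuple R) -> \bar R}) :
    {measure set (LebT mu) -> \bar R} :=
  @completed_measure_extension _ _ _ mu.

(* A real square matrix is positive definite. *)
Definition posdef_mx (R : realType) (m : nat) (M : 'M[R]_m) : Prop :=
  forall v : 'cV[R]_m, v != 0 -> 0 < (v^T *m M *m v) 0 0.

(* A kernel is positive definite on Om: for distinct points the matrix
   (Phi(x_k,x_l)) is positive definite. *)
Definition posdef_kernel (T : Type) (R : realType) (Om : set T)
    (Phi : T -> T -> R) : Prop :=
  forall (m : nat) (x : 'I_m -> T), (forall k, Om (x k)) -> injective x ->
    posdef_mx (\matrix_(k, l) Phi (x k) (x l)).

(* Elements of span{Phi(.,x) : x in Om}, as finite lists of (coefficient, centre). *)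
Definition span_eval (T : Type) (R : realType) (Phi : T -> T -> R)
    (s : seq (R * T)) (y : T) : R :=
  \sum_(p <- s) p.1 * Phi y p.2.
(* Squared native-space norm of such an element. *)
Definition span_norm2 (T : Type) (R : realType) (Phi : T -> T -> R)
    (s : seq (R * T)) : R :=
  \sum_(p <- s) \sum_(q <- s) p.1 * q.1 * Phi p.2 q.2.
Definition span_sub (T : Type) (R : realType) (s t : seq (R * T)) :=
  s ++ [seq (- p.1, p.2) | p <- t].

(* All centres of a span element lie in Om. *)
Definition centres_in (T : Type) (R : realType) (Om : set T) (s : seq (R * T)) : Prop :=
  foldr (fun p P => Om p.2 /\ P) True s.

(* The native space (RKHS) N_Phi(Om), as a set of functions on Om: the
   pointwise limits on Om of native-norm Cauchy sequences in the span of
   {Phi(., x) : x in Om} (standard construction, e.g. Wendland Ch. 10). *)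
Definition native_space (T : Type) (R : realType) (Om : set T)
    (Phi : T -> T -> R) (f : T -> R) : Prop :=
  exists s : nat -> seq (R * T),
    (forall k, centres_in Om (s k)) /\
    (forall e : R, 0 < e -> exists N : nat, forall k l : nat, (N <= k)%N -> (N <= l)%N ->
        span_norm2 Phi (span_sub (s k) (s l)) < e) /\
    (forall y, Om y -> (fun k => span_eval Phi (s k) y) @ \oo --> f y).

(* N_Phi(Om) is dense in L_2(Om) (w.r.t. the measure nu). *)
Definition native_dense_L2 (dT : measure_display) (T : measurableType dT)
    (R : realType) (nu : {measure set T -> \bar R}) (Om : set T)
    (Phi : T -> T -> R) : Prop :=
  forall g : T -> R, measurable_fun Om g ->
    (\int[nu]_(x in Om) ((g x) ^+ 2)%:E < +oo)%E ->
    forall e : R, 0 < e ->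
      exists f : T -> R, native_space Om Phi f /\ measurable_fun Om f /\
        (\int[nu]_(x in Om) ((f x - g x) ^+ 2)%:E < e%:E)%E.

(* Main.v *)
(* Writing g for the combination of the normalised indicators with coefficients v,
   v^T K v is the double integral Q of g(x) g(y) Phi(x,y).  On a compact set Phi is
   a uniform limit of step kernels sum_kl Phi(x_k,x_l) 1_{C_k}(x) 1_{C_l}(y), so for
   bounded functionals L, M one may exchange L_x M_y Phi and L_x L_y Phi >= 0.
   Taking L = <g,.> + t delta_z for all real t gives <g, Phi(.,z)>^2 <= Q Phi(z,z).
   If Q = 0, g is thus orthogonal to every Phi(.,z), hence to the native space,
   where convergence is uniform; by density g = 0 almost everywhere. *)
Require Import Defs.
From HB Require Import structures.
From mathcomp Require Import all_boot all_order all_algebra.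
From mathcomp Require Import all_classical all_reals all_analysis.
From mathcomp Require Import finmap measurable_realfun lra ring.
Import Order.TTheory GRing.Theory Num.Theory.
Import numFieldNormedType.Exports.
Local Open Scope classical_set_scope.
Local Open Scope ring_scope.
Set Implicit Arguments. Unset Strict Implicit. Unset Printing Implicit Defensive.

(** * Real inequalities and semidefiniteness at repeated points *)

Lemma small_le0 (R : realFieldType) (a c : R) :
  (forall e, 0 < e -> a <= c * e) -> a <= 0.
Proof.
move=> h; rewrite leNgt; apply/negP => a0.
have c0 : 0 < `|c| + 1 by rewrite ltr_wpDl.
have := h (a / (2 * (`|c| + 1))); rewrite divr_gt0 ?mulr_gt0// => /(_ isT) /=.
apply/negP; rewrite -ltNge mulrA ltr_pdivrMr ?mulr_gt0//.
have := ler_norm c; nra.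
Qed.

(** For [0 < c] this is the hypothesis at the minimiser [t = - b / c]; for [c = 0] an affine
    function of nonzero slope would take negative values. *)
Lemma quadratic_ge0_discr (R : realFieldType) (a b c : R) : 0 <= c ->
  (forall t, 0 <= a + 2 * t * b + t ^+ 2 * c) -> b ^+ 2 <= a * c.
Proof.
rewrite le_eqVlt => /predU1P[<-|c0] h.
  have [->|b0] := eqVneq b 0; first by rewrite expr0n mulr0.
  (* At this [t] the affine function equals [a - (a + 1) = -1]. *)
  have := h (- (a + 1) / (2 * b)).
  suff -> : 2 * (- (a + 1) / (2 * b)) * b = - (a + 1) by lra.
  by field.
have := h (- b / c).
have -> : a + 2 * (- b / c) * b + (- b / c) ^+ 2 * c = (a * c - b ^+ 2) / c.
  by field; rewrite gt_eqF.
by rewrite ler_pdivlMr// mul0r subr_ge0.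
Qed.

(** The points may repeat here. Adding up the coefficients that share a point reduces to distinct
    points; these sums [B] may all vanish, so only semidefiniteness survives. *)
Lemma posdef_kernel_psd (T : choiceType) (R : realType) (Om : set T)
    (Phi : T -> T -> R) (N : nat) (x : 'I_N -> T) (b : 'I_N -> R) :
  posdef_kernel Om Phi -> (forall k, Om (x k)) ->
  0 <= \sum_k \sum_l Phi (x k) (x l) * b k * b l.
Proof.
move=> Phi_pos Omx.
pose s := undup (codom x).
have xs k : x k \in s by rewrite mem_undup codom_f.
have ixs k : (index (x k) s < size s)%N by rewrite index_mem.
pose f k : 'I_(size s) := Ordinal (ixs k).
pose y := tnth (in_tuple s).
have yf k : y (f k) = x k by rewrite /y (tnth_nth (x k)) /= nth_index.
pose B j := \sum_(k | f k == j) b k.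
have sumB (F : 'I_(size s) -> R) : \sum_k F (f k) * b k = \sum_j F j * B j.
  rewrite (partition_big f predT)//=; apply: eq_bigr => j _.
  by rewrite mulr_sumr; apply: eq_bigr => k /eqP ->.
have -> : \sum_k \sum_l Phi (x k) (x l) * b k * b l =
    \sum_i \sum_j Phi (y i) (y j) * B i * B j.
  transitivity (\sum_k (\sum_j Phi (y (f k)) (y j) * B j) * b k).
    apply: eq_bigr => k _; rewrite -(sumB (fun j => Phi (y (f k)) (y j))) mulr_suml.
    by apply: eq_bigr => l _; rewrite !yf mulrAC.
  rewrite (sumB (fun i => \sum_j Phi (y i) (y j) * B j)).
  by apply: eq_bigr => i _; rewrite mulr_suml; apply: eq_bigr => j _; rewrite mulrAC.
have [B0|B0] := eqVneq (\col_i B i) 0.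
  rewrite big1// => i _; rewrite big1// => j _.
  by move/colP: B0 => /(_ i); rewrite !mxE => ->; rewrite mulr0 mul0r.
have Omy j : Om (y j).
  have : y j \in s by exact: mem_tnth.
  by rewrite mem_undup => /codomP[k ->].
have y_inj : injective y by apply/tuple_uniqP; exact: undup_uniq.
have := Phi_pos _ y Omy y_inj _ B0.
rewrite mxE => /ltW; congr (_ <= _).
rewrite exchange_big/=; apply: eq_bigr => j _.
rewrite !mxE mulr_suml; apply: eq_bigr => i _.
by rewrite !mxE [B i * _]mulrC.
Qed.

(** This is how continuity on a compact set enters the abstract argument. The coefficients are
    values of [Phi] at points of [Om], so the step kernels inherit symmetry and semidefiniteness. *)
Definition step_approximable (dT : measure_display) (T : measurableType dT)
    (R : realType) (Om : set T) (Phi : T -> T -> R) :=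
  forall e : R, 0 < e -> exists N (x : 'I_N -> T) (C : 'I_N -> set T),
    [/\ forall k, Om (x k), forall k, measurable (C k) &
      forall u v, Om u -> Om v ->
        `|Phi u v - \sum_k \sum_l Phi (x k) (x l) * \1_(C k) u * \1_(C l) v| <= e].

(** * Bounded measurable functions and sup-norm bounded functionals *)

Section bounded_measurable.
Context (dT : measure_display) (T : measurableType dT) (R : realType).
Variable Om : set T.

Definition bounded_mfun (f : T -> R) :=
  measurable_fun Om f /\ exists M, forall x, Om x -> `|f x| <= M.

Lemma bounded_mfunD f g : bounded_mfun f -> bounded_mfun g ->
  bounded_mfun (fun x => f x + g x).
Proof.
move=> [mf [M fM]] [mg [M' gM']]; split; first exact: measurable_funD.
by exists (M + M') => x Ox; rewrite (le_trans (ler_normD _ _))// lerD// ?fM ?gM'.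
Qed.

Lemma bounded_mfunM f g : bounded_mfun f -> bounded_mfun g ->
  bounded_mfun (fun x => f x * g x).
Proof.
move=> [mf [M fM]] [mg [M' gM']]; split; first exact: measurable_funM.
by exists (M * M') => x Ox; rewrite normrM ler_pM// ?fM ?gM'.
Qed.

Lemma bounded_mfun_cst c : bounded_mfun (fun=> c).
Proof. by split; [exact: measurable_cst|exists `|c|]. Qed.

Lemma bounded_mfunZ c f : bounded_mfun f -> bounded_mfun (fun x => c * f x).
Proof. by move=> bf; apply: bounded_mfunM => //; exact: bounded_mfun_cst. Qed.

Lemma bounded_mfunB f g : bounded_mfun f -> bounded_mfun g ->
  bounded_mfun (fun x => f x - g x).
Proof.
move=> bf bg; rewrite (_ : (fun _ => _) = fun x => f x + -1 * g x); last first.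
  by apply/funext => x; rewrite mulN1r.
by apply: bounded_mfunD => //; exact: bounded_mfunZ.
Qed.

Lemma bounded_mfun_indic (A : set T) : measurable A -> bounded_mfun \1_A.
Proof.
move=> mA; split; first exact: measurable_indic.
by exists 1 => x _; rewrite indicE ger0_norm// lern1 leq_b1.
Qed.

Lemma bounded_mfun_sum (I : Type) (s : seq I) (f : I -> T -> R) :
  (forall i, bounded_mfun (f i)) -> bounded_mfun (fun x => \sum_(i <- s) f i x).
Proof.
move=> bf; elim: s => [|i s ih].
  rewrite (_ : (fun _ => _) = fun=> 0); first exact: bounded_mfun_cst.
  by apply/funext => x; rewrite big_nil.
rewrite (_ : (fun _ => _) = fun x => f i x + \sum_(j <- s) f j x).
  exact: bounded_mfunD.
by apply/funext => x; rewrite big_cons.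
Qed.

(** One approximant at distance 1 gives the bound; measurability passes to the limit of approximants
    at distance [1 / (n + 1)]. *)
Lemma bounded_mfun_unif f :
  (forall e : R, 0 < e -> exists2 g, bounded_mfun g &
    forall x, Om x -> `|f x - g x| <= e) -> bounded_mfun f.
Proof.
move=> h; split; last first.
  have [g [_ [M gM]] fg] := h 1 ltr01.
  exists (1 + M) => x Ox.
  by rewrite -(subrK (g x) (f x)) (le_trans (ler_normD _ _))// lerD ?fg ?gM.
have /choice[g hg] : forall n : nat, exists g, bounded_mfun g /\
    forall x, Om x -> `|f x - g x| <= n.+1%:R^-1.
  by move=> n; have [|g] := h n.+1%:R^-1; [rewrite invr_gt0|exists g].
apply: (@measurable_fun_cvg _ _ _ _ g) => [n|x Ox]; first by case: (hg n) => -[].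
apply/cvgrPdist_le => e e0.
have := near_infty_natSinv_lt (PosNum e0); apply: filterS => n /= /ltW ne.
exact: le_trans ((hg n).2 x Ox) ne.
Qed.

(** Covers weighted integrals and point evaluations alike. Linearity is asked on bounded measurable
    functions only, and the constant [c] may have any sign. *)
Definition bounded_functional (L : (T -> R) -> R) :=
  (forall a f g, bounded_mfun f -> bounded_mfun g ->
    L (fun x => a * f x + g x) = a * L f + L g) /\
  (exists c, forall f e, 0 <= e -> bounded_mfun f ->
    (forall x, Om x -> `|f x| <= e) -> `|L f| <= c * e).

Section functional.
Variable L : (T -> R) -> R.
Hypothesis bL : bounded_functional L.

Lemma functional0 : L (fun=> 0) = 0.
Proof.
have := bL.1 1 _ _ (bounded_mfun_cst 0) (bounded_mfun_cst 0).
rewrite (_ : (fun=> _) = fun=> 0); first by lra.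
by apply/funext => x; rewrite mulr0 addr0.
Qed.

Lemma functionalZ a f : bounded_mfun f -> L (fun x => a * f x) = a * L f.
Proof.
move=> bf; rewrite -[RHS]addr0 -functional0 -bL.1//; last exact: bounded_mfun_cst.
by congr L; apply/funext => x; rewrite addr0.
Qed.

Lemma functionalD f g : bounded_mfun f -> bounded_mfun g ->
  L (fun x => f x + g x) = L f + L g.
Proof.
move=> bf bg; rewrite -[L f]mul1r -bL.1//.
by congr L; apply/funext => x; rewrite mul1r.
Qed.

Lemma functionalB f g : bounded_mfun f -> bounded_mfun g ->
  L (fun x => f x - g x) = L f - L g.
Proof.
move=> bf bg; rewrite -[- L g]mulN1r addrC -bL.1//.
by congr L; apply/funext => x; rewrite mulN1r addrC.
Qed.

Lemma functional_sum (I : Type) (s : seq I) (f : I -> T -> R) :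
  (forall i, bounded_mfun (f i)) ->
  L (fun x => \sum_(i <- s) f i x) = \sum_(i <- s) L (f i).
Proof.
move=> bf; elim: s => [|i s ih].
  rewrite big_nil -[RHS]functional0; congr L.
  by apply/funext => x; rewrite big_nil.
rewrite big_cons -ih -functionalD//; last exact: bounded_mfun_sum.
by congr L; apply/funext => x; rewrite big_cons.
Qed.

(** The sup bound at [e = 0], applied to [f - g]: a bounded functional sees only values on [Om]. *)
Lemma functional_eq f g : bounded_mfun f -> bounded_mfun g ->
  (forall x, Om x -> f x = g x) -> L f = L g.
Proof.
move=> bf bg fg; have [c hc] := bL.2.
apply/eqP; rewrite -subr_eq0 -normr_le0 -functionalB// -[leRHS](mulr0 c).
by apply: hc => //; [exact: bounded_mfunB|move=> x /fg ->; rewrite subrr normr0].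
Qed.

End functional.

Lemma functional_lin_bounded a (L M : (T -> R) -> R) :
  bounded_functional L -> bounded_functional M ->
  bounded_functional (fun f => a * L f + M f).
Proof.
move=> bL bM; split=> [b f g bf bg|]; first by rewrite bL.1// bM.1//; ring.
have [[c hc] [c' hc']] := (bL.2, bM.2); exists (`|a| * c + c') => f e e0 bf fe.
rewrite (le_trans (ler_normD _ _))// mulrDl lerD ?hc'// normrM -mulrA.
by rewrite ler_wpM2l// hc.
Qed.

Lemma functional_cst0_bounded : bounded_functional (fun=> 0).
Proof.
split=> [a f g _ _|]; first by rewrite mulr0 addr0.
by exists 0 => f e _ _ _; rewrite normr0 mul0r.
Qed.

Lemma functional_sum_bounded (I : Type) (s : seq I) (a : I -> R)
    (L : I -> (T -> R) -> R) :
  (forall i, bounded_functional (L i)) ->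
  bounded_functional (fun f => \sum_(i <- s) a i * L i f).
Proof.
move=> bL; elim: s => [|i s ih].
  under eq_fun do rewrite big_nil; exact: functional_cst0_bounded.
under eq_fun do rewrite big_cons; exact: functional_lin_bounded.
Qed.

Lemma functional_mul_bounded g (L : (T -> R) -> R) : bounded_mfun g ->
  bounded_functional L -> bounded_functional (fun f => L (fun x => g x * f x)).
Proof.
move=> bg bL; split=> [a f h bf bh|].
  rewrite -bL.1//; last 2 first; try exact: bounded_mfunM.
  by congr L; apply/funext => x; ring.
have [[c hc] [_ [M gM]]] := (bL.2, bg); exists (c * `|M|) => f e e0 bf fe.
rewrite -mulrA hc ?mulr_ge0//; first exact: bounded_mfunM.
move=> x Ox; rewrite normrM ler_pM// ?fe//.
by rewrite (le_trans (gM _ Ox))// ler_norm.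
Qed.

Lemma functional_eval_bounded z : Om z -> bounded_functional (fun f => f z).
Proof.
by move=> Oz; split=> //; exists 1 => f e _ _ fe; rewrite mul1r fe.
Qed.

End bounded_measurable.

(** * Pairs of bounded functionals applied to the kernel *)

Section kernel.
Context (dT : measure_display) (T : measurableType dT) (R : realType).
Variables (Om : set T) (Phi : T -> T -> R).
Hypothesis Phi_sym : forall x y, Om x -> Om y -> Phi x y = Phi y x.
Hypothesis Phi_pos : posdef_kernel Om Phi.
Hypothesis Phi_step : step_approximable Om Phi.
Local Notation bounded_mfun := (bounded_mfun Om).
Local Notation bounded_functional := (bounded_functional Om).

Lemma bounded_mfun_stepr N (x : 'I_N -> T) (C : 'I_N -> set T) u :
  (forall k, measurable (C k)) -> bounded_mfun (fun v =>
    \sum_k \sum_l Phi (x k) (x l) * \1_(C k) u * \1_(C l) v).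
Proof.
move=> mC; apply: bounded_mfun_sum => k; apply: bounded_mfun_sum => l.
by apply: bounded_mfunZ; exact: bounded_mfun_indic.
Qed.

Lemma bounded_mfun_kernel u : Om u -> bounded_mfun (Phi u).
Proof.
move=> Ou; apply: bounded_mfun_unif => e e0.
have [N [x [C [Ox mC xC]]]] := Phi_step e0.
by eexists; [exact: (bounded_mfun_stepr x u mC)|move=> v Ov; exact: xC].
Qed.

Section functional_kernel.
Variable M : (T -> R) -> R.
Hypothesis bM : bounded_functional M.

Let functional_step N (x : 'I_N -> T) (C : 'I_N -> set T) u :
  (forall k, measurable (C k)) ->
  M (fun v => \sum_k \sum_l Phi (x k) (x l) * \1_(C k) u * \1_(C l) v) =
  \sum_k (\sum_l Phi (x k) (x l) * M \1_(C l)) * \1_(C k) u.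
Proof.
move=> mC.
have bmC l := bounded_mfun_indic R Om (mC l).
rewrite (functional_sum bM); last first.
  by move=> k; apply: bounded_mfun_sum => l; exact: bounded_mfunZ.
apply: eq_bigr => k _; rewrite (functional_sum bM); last first.
  by move=> l; exact: bounded_mfunZ.
rewrite mulr_suml; apply: eq_bigr => l _.
by rewrite (functionalZ bM)// mulrAC.
Qed.

(** The constant depends on [M] alone, neither on [e] nor on the step kernel, so that [e] can later
    tend to 0. *)
Lemma functional_kernel_step : exists2 c, 0 <= c & forall e, 0 < e ->
  forall N (x : 'I_N -> T) (C : 'I_N -> set T), (forall k, measurable (C k)) ->
  (forall u v, Om u -> Om v ->
    `|Phi u v - \sum_k \sum_l Phi (x k) (x l) * \1_(C k) u * \1_(C l) v| <= e) ->
  forall u, Om u ->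
  `|M (Phi u) - \sum_k (\sum_l Phi (x k) (x l) * M \1_(C l)) * \1_(C k) u| <= c * e.
Proof.
have [c hc] := bM.2; exists `|c| => // e e0 N x C mC xC u Ou.
rewrite -functional_step// -(functionalB bM); last 2 first.
- exact: bounded_mfun_kernel.
- exact: bounded_mfun_stepr.
have e0' := ltW e0.
apply: (@le_trans _ _ (c * e)); last by rewrite ler_wpM2r// ler_norm.
apply: hc => //; last by move=> v Ov; exact: xC.
apply: bounded_mfunB; [exact: bounded_mfun_kernel|exact: bounded_mfun_stepr].
Qed.

(** A uniform limit of simple functions. This makes it legitimate to apply a second functional to
    [M (Phi u)]. *)
Lemma bounded_mfun_functional : bounded_mfun (fun u => M (Phi u)).
Proof.
apply: bounded_mfun_unif => e e0.
have [c c0 hc] := functional_kernel_step.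
(* [c] may be 0, hence the division by [c + 1]. *)
have c1 : 0 < c + 1 by rewrite ltr_wpDl.
have e1 : 0 < e / (c + 1) by rewrite divr_gt0.
have [N [x [C [Ox mC xC]]]] := Phi_step e1.
exists (fun u => \sum_k (\sum_l Phi (x k) (x l) * M \1_(C l)) * \1_(C k) u).
  by apply: bounded_mfun_sum => k; apply: bounded_mfunZ; exact: bounded_mfun_indic.
move=> u Ou; rewrite (le_trans (hc _ e1 _ _ _ mC xC _ Ou))//.
by rewrite mulrCA ler_piMr ?(ltW e0)// ler_pdivrMr// mul1r lerDl.
Qed.

End functional_kernel.

Lemma functional2_approx L M : bounded_functional L -> bounded_functional M ->
  exists2 c, 0 <= c & forall e, 0 < e ->
  forall N (x : 'I_N -> T) (C : 'I_N -> set T), (forall k, measurable (C k)) ->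
  (forall u v, Om u -> Om v ->
    `|Phi u v - \sum_k \sum_l Phi (x k) (x l) * \1_(C k) u * \1_(C l) v| <= e) ->
  `|L (fun u => M (Phi u)) -
    \sum_k \sum_l Phi (x k) (x l) * L \1_(C k) * M \1_(C l)| <= c * e.
Proof.
move=> bL bM; have [c c0 hc] := functional_kernel_step bM.
have [c' hc'] := bL.2; exists (`|c'| * c); first by rewrite mulr_ge0.
move=> e e0 N x C mC xC.
have bs k : bounded_mfun
    (fun u => (\sum_l Phi (x k) (x l) * M \1_(C l)) * \1_(C k) u).
  by apply: bounded_mfunZ; exact: bounded_mfun_indic.
have -> : \sum_k \sum_l Phi (x k) (x l) * L \1_(C k) * M \1_(C l) =
    L (fun u => \sum_k (\sum_l Phi (x k) (x l) * M \1_(C l)) * \1_(C k) u).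
  rewrite (functional_sum bL)//; apply: eq_bigr => k _.
  rewrite (functionalZ bL)//; last exact: bounded_mfun_indic.
  by rewrite mulr_suml; apply: eq_bigr => l _; rewrite mulrAC.
rewrite -(functionalB bL); last 2 first.
- exact: bounded_mfun_functional.
- exact: bounded_mfun_sum.
have ce0 : 0 <= c * e by rewrite mulr_ge0// ltW.
apply: (@le_trans _ _ (c' * (c * e))).
  apply: hc' => //.
    by apply: bounded_mfunB; [exact: bounded_mfun_functional|exact: bounded_mfun_sum].
  by move=> u Ou; exact: hc.
by rewrite -mulrA ler_wpM2r// ler_norm.
Qed.

(** Plays the role of Fubini's theorem: both iterated values are within a multiple of [e] of the
    same finite double sum, once [Phi] is flipped at the centres and the sums are exchanged. *)
Lemma functional2C L M : bounded_functional L -> bounded_functional M ->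
  L (fun u => M (Phi u)) = M (fun u => L (Phi u)).
Proof.
move=> bL bM.
have [c c0 hc] := functional2_approx bL bM.
have [c' c'0 hc'] := functional2_approx bM bL.
apply/eqP; rewrite -subr_eq0 -normr_le0; apply: (@small_le0 _ _ (c + c')) => e e0.
have [N [x [C [Ox mC xC]]]] := Phi_step e0.
rewrite mulrDl; apply: le_trans (lerD (hc _ e0 _ _ _ mC xC) (hc' _ e0 _ _ _ mC xC)).
rewrite [in X in _ <= _ + X]distrC exchange_big/=.
under eq_bigr do under eq_bigr do rewrite Phi_sym// mulrAC.
by rewrite (le_trans _ (ler_normD _ _))// addrA subrK.
Qed.

(** The approximating double sum is the quadratic form of [Phi] at the centres with coefficients
    [L \1_(C k)], hence nonnegative; the error [c * e] is arbitrarily small. *)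
Lemma functional2_ge0 L : bounded_functional L -> 0 <= L (fun u => L (Phi u)).
Proof.
move=> bL; have [c c0 hc] := functional2_approx bL bL.
rewrite -oppr_le0; apply: (@small_le0 _ _ c) => e e0.
have [N [x [C [Ox mC xC]]]] := Phi_step e0.
have := hc _ e0 _ _ _ mC xC; rewrite ler_norml => /andP[+ _].
have := posdef_kernel_psd (fun k => L \1_(C k)) Phi_pos Ox; lra.
Qed.

(** Cauchy-Schwarz between [L] and evaluation at [z], for the semidefinite form that sends [L], [M]
    to [L (fun u => M (Phi u))]. *)
Lemma functional_kernel_sqr L z : bounded_functional L -> Om z ->
  L (Phi z) ^+ 2 <= L (fun u => L (Phi u)) * Phi z z.
Proof.
move=> bL Oz; have bz := functional_eval_bounded R Oz.
apply: quadratic_ge0_discr => [|t]; first exact: (functional2_ge0 bz).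
have bLz : bounded_functional (fun f => t * f z + L f).
  exact: functional_lin_bounded.
have := functional2_ge0 bLz; rewrite bL.1//; last 2 first.
- exact: (bounded_mfun_functional bz).
- exact: bounded_mfun_functional.
(* The two cross terms agree by the exchange, which yields the coefficient [2 * t]. *)
by have /= -> := functional2C bL bz; congr (_ <= _); ring.
Qed.

(** A step kernel at distance 1 is bounded by the sum of the absolute values of its coefficients. *)
Lemma kernel_diag_le : exists M, forall z, Om z -> Phi z z <= M.
Proof.
have [N [x [C [Ox mC xC]]]] := Phi_step (@ltr01 R).
exists (1 + \sum_k \sum_l `|Phi (x k) (x l)|) => z Oz.
have := xC z z Oz Oz; rewrite ler_norml => /andP[_].
rewrite lerBlDr => /le_trans; apply; rewrite lerD2l.
apply: ler_sum => k _; apply: ler_sum => l _.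
rewrite -mulrA (le_trans (ler_norm _))// normrM ler_piMr// !indicE -natrM.
by rewrite ger0_norm// lern1; do 2 case: (_ \in _).
Qed.

Lemma span_functional_bounded (s : seq (R * T)) : centres_in Om s ->
  bounded_functional (fun f => \sum_(p <- s) p.1 * f p.2).
Proof.
elim: s => [_|p s ih /= [Op /ih bs]].
  under eq_fun do rewrite big_nil; exact: functional_cst0_bounded.
under eq_fun do rewrite big_cons.
exact: (functional_lin_bounded p.1 (functional_eval_bounded R Op)).
Qed.

(** For the functional with weights [p.1] at the centres [p.2], the double application to [Phi] is
    [span_norm2 Phi s], so this is an instance of [functional_kernel_sqr]. *)
Lemma span_eval_sqr s z : centres_in Om s -> Om z ->
  span_eval Phi s z ^+ 2 <= span_norm2 Phi s * Phi z z.
Proof.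
move=> Os Oz; have := functional_kernel_sqr (span_functional_bounded Os) Oz.
congr (_ <= _ * _); apply: eq_bigr => p _; rewrite mulr_sumr.
by apply: eq_bigr => q _; rewrite mulrA.
Qed.

Lemma bounded_mfun_span_eval s : centres_in Om s -> bounded_mfun (span_eval Phi s).
Proof. by move=> /span_functional_bounded; exact: bounded_mfun_functional. Qed.

End kernel.

(** * The native space and the use of its density *)

Lemma span_eval_sub (T : Type) (R : realType) (Phi : T -> T -> R) s t y :
  span_eval Phi (span_sub s t) y = span_eval Phi s y - span_eval Phi t y.
Proof.
rewrite /span_eval big_cat/= big_map -sumrN; congr (_ + _).
by apply: eq_bigr => p _; rewrite mulNr.
Qed.

Lemma centres_in_sub (T : Type) (R : realType) (Om : set T) (s t : seq (R * T)) :
  centres_in Om s -> centres_in Om t -> centres_in Om (span_sub s t).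
Proof.
rewrite /span_sub; elim: s => [_|p s ih /= [Op Os] Ot]; last by split; [|exact: ih].
by elim: t => //= q t ih [Oq /ih].
Qed.

Section density.
Context (dT : measure_display) (T : measurableType dT) (R : realType).
Variables (Om : set T) (Phi : T -> T -> R).
Hypothesis Phi_sym : forall x y, Om x -> Om y -> Phi x y = Phi y x.
Hypothesis Phi_pos : posdef_kernel Om Phi.
Hypothesis Phi_step : step_approximable Om Phi.
Local Notation bounded_mfun := (bounded_mfun Om).
Local Notation bounded_functional := (bounded_functional Om).

(* Convergence in native norm is uniform on [Om], since
   [|f z|^2 <= |f|^2 Phi z z] and [Phi] is bounded. *)
Lemma native_space_unif f e : native_space Om Phi f -> 0 < e ->
  exists2 s, centres_in Om s & forall z, Om z -> (f z - span_eval Phi s z) ^+ 2 <= e.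
Proof.
move=> [s [Os [s_cauchy s_f]]] e0; have [M hM] := kernel_diag_le Phi_step.
have M1 : 0 < `|M| + 1 by rewrite ltr_wpDl.
have eM : 0 < e / (`|M| + 1) by rewrite divr_gt0.
have [N hN] := s_cauchy _ eM; exists (s N) => // z Oz.
have sq : (fun k => (span_eval Phi (s k) z - span_eval Phi (s N) z) ^+ 2) @ \oo -->
    (f z - span_eval Phi (s N) z) ^+ 2.
  by apply: cvgM; apply: cvgB; [exact: s_f|exact: cvg_cst|exact: s_f|exact: cvg_cst].
(* With [N] fixed, a bound valid for every [k >= N] passes to the limit in [k]. *)
apply: (cvgr_to_le sq); exists N => // k /= Nk; rewrite -span_eval_sub.
have Oss := centres_in_sub (Os k) (Os N).
apply: (le_trans (span_eval_sqr Phi_sym Phi_pos Phi_step Oss Oz)).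
have zz0 : 0 <= Phi z z.
  exact: (functional2_ge0 Phi_pos Phi_step (functional_eval_bounded R Oz)).
apply: (@le_trans _ _ (e / (`|M| + 1) * (`|M| + 1))); last first.
  by rewrite divfK// gt_eqF.
apply: (@le_trans _ _ (e / (`|M| + 1) * Phi z z)).
  by apply: ler_wpM2r => //; apply/ltW/hN.
apply: ler_wpM2l; first exact: ltW.
by rewrite (le_trans (hM _ Oz))// (le_trans (ler_norm _))// lerDl.
Qed.

Variable nu : {measure set T -> \bar R}.
Hypothesis mOm : measurable Om.
Hypothesis Om_fin : (nu Om < +oo)%E.
Local Notation I := (Rintegral nu Om).

Lemma bounded_mfun_integrable f : bounded_mfun f -> nu.-integrable Om (EFin \o f).
Proof.
move=> [mf [M fM]]; apply: measurable_bounded_integrable => //.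
exists M; split; first exact: num_real.
by move=> y My x Ox /=; rewrite (le_trans (fM _ Ox))// ltW.
Qed.

Lemma integral_bounded_functional : bounded_functional I.
Proof.
split=> [a f g bf bg|].
  rewrite RintegralD//; last 2 first.
  - exact/bounded_mfun_integrable/bounded_mfunZ.
  - exact: bounded_mfun_integrable.
  by rewrite RintegralZl//; exact: bounded_mfun_integrable.
exists (fine (nu Om)) => f e e0 bf fe.
have intf := bounded_mfun_integrable bf.
rewrite (le_trans (le_normr_Rintegral mOm intf))// mulrC -Rintegral_cst//.
apply: le_Rintegral => //; first exact: integrable_norm.
exact/bounded_mfun_integrable/bounded_mfun_cst.
Qed.

(** Rewrites integrals over subsets as integrals over the one set [Om], on which the functionals are
    defined. *)
Lemma Rintegral_sub_indic A h : A `<=` Om ->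
  Rintegral nu A h = I (fun x => \1_A x * h x).
Proof.
move=> AO; rewrite -[in LHS](setIidr AO) Rintegral_mkcondr.
apply: eq_Rintegral => x _.
by rewrite patchE indicE; case: ifPn; rewrite ?mul1r ?mul0r.
Qed.

Lemma ae_eq0_of_kernel_form_eq0 g : native_dense_L2 nu Om Phi -> bounded_mfun g ->
  I (fun x => g x * I (fun y => g y * Phi x y)) = 0 ->
  {ae nu, forall x, Om x -> g x = 0}.
Proof.
move=> dense bg form0.
have bI := integral_bounded_functional.
have bL := functional_mul_bounded bg bI.
(* Cauchy-Schwarz with a vanishing form on the right. *)
have gPhi0 z : Om z -> I (fun y => g y * Phi z y) = 0.
  move=> Oz; have := functional_kernel_sqr Phi_sym Phi_pos Phi_step bL Oz.
  by rewrite form0 mul0r => h; apply/eqP; rewrite -sqrf_eq0 eq_le h sqr_ge0.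
have gs0 s : centres_in Om s -> I (fun x => g x * span_eval Phi s x) = 0.
  move=> Os; have bs := span_functional_bounded Os.
  (* Moves the integral inside the finite sum over the centres, where [gPhi0] kills each term. *)
  have /= -> := functional2C Phi_sym Phi_step bL bs.
  elim: s Os {bs} => [|p s ih /= [Op /ih s0]]; first by rewrite big_nil.
  by rewrite big_cons s0 gPhi0// mulr0 addr0.
have bgg : bounded_mfun (fun x => g x * g x) by exact: bounded_mfunM.
have Ige0 f : (forall x, Om x -> 0 <= f x) -> 0 <= I f by exact: Rintegral_ge0.
have gg0 : I (fun x => g x * g x) <= 0.
  apply: (@small_le0 _ _ (2 + 2 * fine (nu Om))) => e e0.
  have [|f [nf [mf fg]]] := dense g bg.1 _ e e0.
    under eq_integral do rewrite expr2.
    exact/integral_fune_lt_pinfty/(bounded_mfun_integrable bgg).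
  have [s Os fs] := native_space_unif nf e0.
  have bs := bounded_mfun_span_eval Phi_step Os.
  have bf : bounded_mfun f.
    (* Density provides [f] as merely measurable. It is bounded because [s] is and [(f - s)^2 <= e],
       using [|t| <= 1 + t^2]. *)
    split => //; have [_ [M sM]] := bs; exists (1 + e + M) => x Ox.
    rewrite -(subrK (span_eval Phi s x) (f x)) (le_trans (ler_normD _ _))//.
    apply: lerD; last exact: sM.
    have := fs x Ox; rewrite -real_normK ?num_real//.
    have := normr_ge0 (f x - span_eval Phi s x); nra.
  have bfg : bounded_mfun (fun x => (f x - g x) ^+ 2).
    by under eq_fun do rewrite expr2; apply: bounded_mfunM; exact: bounded_mfunB.
  have bgs := bounded_mfunM bg bs.
  have Ifg : I (fun x => (f x - g x) ^+ 2) < e.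
    rewrite -lte_fin /Rintegral fineK//.
    exact: (integrable_fin_num mOm (bounded_mfun_integrable bfg)).
  have -> : I (fun x => g x * g x) =
      I (fun x => - 2 * (g x * span_eval Phi s x) + g x * g x).
    by rewrite bI.1// gs0// mulr0 add0r.
  (* Writing [s] for the span element, [g^2 - 2 g s <= (g - s)^2 <= 2 (f - g)^2 + 2 (f - s)^2]. The
     last term is at most [2 * e], whence the constant [2 + 2 * fine (nu Om)]. *)
  apply: (@le_trans _ _ (I (fun x => 2 * (f x - g x) ^+ 2 + 2 * e))).
    apply: le_Rintegral => //.
    - apply: bounded_mfun_integrable; apply: bounded_mfunD => //.
      exact: bounded_mfunZ.
    - apply: bounded_mfun_integrable; apply: bounded_mfunD; first exact: bounded_mfunZ.
      exact: bounded_mfun_cst.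
    - move=> x Ox; have := fs x Ox.
      have := sqr_ge0 (span_eval Phi s x).
      have := sqr_ge0 (f x - g x + (f x - span_eval Phi s x)).
      by rewrite !expr2; nra.
  rewrite bI.1//; last exact: bounded_mfun_cst.
  by rewrite Rintegral_cst//; lra.
have /ae_eq_integral_abs : measurable_fun Om (fun x => (g x * g x)%:E).
  by apply/measurable_EFinP; case: bgg.
move=> /(_ nu mOm)[+ _].
have -> : (\int[nu]_(x in Om) `|(g x * g x)%:E| = 0)%E.
  under eq_integral do rewrite /= ger0_norm -?expr2 ?sqr_ge0//.
  under eq_integral do rewrite expr2.
  rewrite -[LHS]fineK; last first.
    exact: (integrable_fin_num mOm (bounded_mfun_integrable bgg)).
  congr (_%:E); apply/eqP; rewrite eq_le gg0/=.
  by apply: Ige0 => x _; rewrite -expr2 sqr_ge0.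
move=> /(_ erefl); apply: filterS => x /= + Ox => /(_ Ox) [] /eqP.
by rewrite mulf_eq0 orbb => /eqP.
Qed.

End density.


(** * Compact sets of Euclidean space: uniform continuity, measurability, step kernels *)

Lemma compact_uniform_modulus (R : realType) (X : pseudoMetricType R) (K : set X)
    (f : X -> R) (e : R) : compact K -> {within K, continuous f} -> 0 < e ->
  exists2 r, 0 < r & forall p q, K p -> K q -> ball p r q -> `|f p - f q| <= e.
Proof.
move=> /compact_near_coveringP/near_covering_withinP cK /subspace_continuousP fK e0.
have : \forall r \near 0^'+,
    K `<=` (fun p => forall q, K q -> ball p r q -> `|f p - f q| <= e).
  apply: cK => x Kx.
  have /cvgrPdist_le/(_ (e / 2)) := fK x Kx; rewrite divr_gt0// => /(_ isT).
  rewrite near_withinE => /nbhs_ballP[s /= s0 hs].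
  have s2 : 0 < s / 2 by rewrite divr_gt0.
  (* Heine-Cantor with halved radii: [p] within [s / 2] of [x] and [q] within [r < s / 2] of [p]
     both lie within [s] of [x]. *)
  exists (ball x (s / 2), [set r | r < s / 2]) => /=.
    by split; [exact: nbhsx_ballx|exact: nbhs_right_lt].
  move=> [p r] [/= xp rs] Kp q Kq pq.
  have xs : ball x s p by apply: le_ball xp; rewrite ler_pdivrMr// ler_peMr ?ler1n// ltW.
  have qs : ball x s q.
    by rewrite (splitr s); apply: ball_triangle xp _; exact: le_ball (ltW rs) _ pq.
  rewrite -(subrK (f x) (f p)) -addrA (le_trans (ler_normD _ _))// [leRHS]splitr.
  by apply: lerD; [rewrite distrC|]; exact: hs.
move=> h; have [r [r0 hr]] : exists r, 0 < r /\
    (K `<=` (fun p => forall q, K q -> ball p r q -> `|f p - f q| <= e)).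
  near (0 : R)^'+ => r; exists r; split; first by [].
  by near: r.
by exists r => // p q Kp; exact: hr.
Unshelve. all: by end_near. Qed.

Lemma compact_finite_net (R : realType) (X : normedModType R) (K : set X) (r : R) :
  compact K -> 0 < r -> exists N (x : 'I_N -> X), (forall k, K (x k)) /\
    forall u, K u -> exists k, ball (x k) r u.
Proof.
rewrite compact_cover => cK r0.
have [|u Ku|D DK KD] := cK _ K (fun c => (ball c r)^°).
- by move=> c _; exact: open_interior.
- by exists u => //; exact: nbhsx_ballx.
exists (size (enum_fset D)), (tnth (in_tuple (enum_fset D))); split=> [k|u /KD].
  by apply/set_mem/DK; exact: mem_tnth.
move=> [c /= /(tnthP (in_tuple (enum_fset D)))[k ->] cu].
by exists k; exact: interior_subset cu.
Qed.

Lemma to_rVK (R : realType) d : cancel (@to_rV R d) (@of_rV R d).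
Proof. by move=> x; apply: eq_from_tnth => i; rewrite tnth_mktuple mxE. Qed.

Section euclidean.
Context (R : realType) (d : nat) (mu : {measure set (d.-tuple R) -> \bar R}).
Variable Om : set (LebT mu).
Hypothesis Om_compact : compact (@to_rV R d @` Om).

Lemma sub_LebT_measurable (A : set (d.-tuple R)) :
  measurable A -> measurable (A : set (LebT mu)).
Proof. by move=> mA; apply: sub_caratheodory; exact: sub_sigma_algebra. Qed.

Lemma leb_measurableE (A : set (d.-tuple R)) : measurable A -> leb mu A = mu A.
Proof. exact: measurable_mu_extE. Qed.

(** Balls of row vectors are for the maximum norm, so this is an open cube, cut out by one condition
    per coordinate. *)
Let cube (c : d.-tuple R) (r : R) : set (LebT mu) :=
  [set x | ball (to_rV c) r (to_rV x)].

Let measurable_cube c r : measurable (cube c r).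
Proof.
pose B : set (d.-tuple R) := [set x | ball (to_rV c) r (to_rV x)].
apply: (@sub_LebT_measurable B).
(* A ball of matrices requires [0 < r]. For [d = 0] the coordinate conditions are vacuous and would
   not enforce this. *)
have [r0|r0] := ltP 0 r; last first.
  suff -> : B = set0 by exact: measurable0.
  by apply/seteqP; split => // x /= [/lt_le_trans/(_ r0)]; rewrite ltxx.
have -> : B = \bigcap_(i in [set: 'I_d]) ((@tnth d R)^~ i @^-1` ball (tnth c i) r).
  apply/seteqP; split => [x [_ h] i _|x h].
    by have := h ord0 i; rewrite !mxE.
  by split => // i j; rewrite !mxE; exact: h.
apply: fin_bigcap_measurable => [|i _]; first exact: finite_finset.
rewrite -[X in measurable X]setTI; apply: measurable_tnth => //.
exact: measurable_ball.
Qed.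

Let finite_net (r : R) : 0 < r -> exists N (x : 'I_N -> LebT mu),
  (forall k, Om (x k)) /\ forall u, Om u -> exists k, cube (x k) r u.
Proof.
move=> r0; have [N [x [Kx xK]]] := @compact_finite_net R 'rV[R]_d _ r Om_compact r0.
exists N, (fun k => of_rV (x k)).
have ofK k : Om (of_rV (x k)) /\ to_rV (of_rV (x k)) = x k.
  by have [y Oy <-] := Kx k; rewrite to_rVK.
split=> [k|u Ou]; first by case: (ofK k).
have [|k xu] := xK (to_rV u); first by exists u.
by exists k; rewrite /cube/= (ofK k).2.
Qed.

(** [Om] is the countable intersection of finite unions of cubes of radius [1 / (n + 1)] centred in
    [Om]: a point of all these unions is adherent to [Om], which is closed. *)
Lemma compact_LebT_measurable : measurable Om.
Proof.
have /choice[N hN] : forall n : nat, exists N, exists x : 'I_N -> LebT mu,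
    (forall k, Om (x k)) /\ forall u, Om u -> exists k, cube (x k) n.+1%:R^-1 u.
  by move=> n; apply: finite_net; rewrite invr_gt0.
pose B n := \bigcup_(k in [set: 'I_(N n)]) cube (projT1 (cid (hN n)) k) n.+1%:R^-1.
have -> : Om = \bigcap_n B n.
  apply/seteqP; split => [u Ou n _|u Bu].
    rewrite /B; case: cid => x /= [Ox xO].
    by have [k ku] := xO u Ou; exists k.
  suff [v Ov uv] : (@to_rV R d @` Om) (to_rV u) by rewrite -(to_rVK u) -uv to_rVK.
  apply: (compact_closed (@norm_hausdorff _ _) Om_compact) => A /nbhs_ballP[e /= e0 eA].
  near \oo => n.
  have := Bu n I; rewrite /B; case: cid => x /= [Ox xO] [k _ xu].
  exists (to_rV (x k)); split; first by exists (x k).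
  apply: eA; apply: ball_sym; apply: le_ball xu; apply: ltW.
  by near: n; exact: near_infty_natSinv_lt (PosNum e0).
apply: bigcapT_measurable => n; apply: fin_bigcup_measurable => [|k _].
  exact: finite_finset.
exact: measurable_cube.
Unshelve. all: by end_near. Qed.

Lemma compact_LebT_fin : is_box_volume mu -> (leb mu Om < +oo)%E.
Proof.
move=> mu_box; have [N [x [Ox xO]]] := finite_net ltr01.
(* Each point of [Om] is within 1 of some centre, so this [M] bounds all its coordinates. *)
pose M := \sum_k \sum_i `|tnth (x k) i| + 1.
have M0 : 0 <= M by rewrite addr_ge0// sumr_ge0// => k _; rewrite sumr_ge0.
pose a : d.-tuple R := [tuple - M | i < d].
pose b : d.-tuple R := [tuple M | i < d].
pose box := [set u : d.-tuple R | forall i, tnth a i <= tnth u i <= tnth b i].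
have mbox : measurable box.
  have -> : box = \bigcap_(i in [set: 'I_d])
      ((@tnth d R)^~ i @^-1` `[tnth a i, tnth b i]).
    apply/seteqP; split => [u h i _|u h i]; first by rewrite /= in_itv/=; exact: h.
    by have := h i I; rewrite /= in_itv.
  apply: fin_bigcap_measurable => [|i _]; first exact: finite_finset.
  by rewrite -[X in measurable X]setTI; apply: measurable_tnth.
have Obox : Om `<=` box.
  move=> u Ou i; rewrite !tnth_mktuple -ler_norml.
  have [k [_ /(_ ord0 i)]] := xO u Ou; rewrite !mxE /= => xu.
  rewrite -(subrK (tnth (x k) i) (tnth u i)) (le_trans (ler_normD _ _))// addrC.
  rewrite /M lerD//; last by rewrite distrC ltW.
  rewrite (bigD1 k)//= (bigD1 i)//= -addrA lerDl addr_ge0 ?sumr_ge0// => l _.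
  by rewrite sumr_ge0.
apply: (@le_lt_trans _ _ (leb mu box)).
  apply: le_measure Obox; apply: mem_set; first exact: compact_LebT_measurable.
  exact: sub_LebT_measurable.
rewrite leb_measurableE// mu_box ?ltry// => i.
by rewrite !tnth_mktuple; lra.
Qed.

Lemma continuous_step_approximable (Phi : LebT mu -> LebT mu -> R) :
  {within (@to_rV R d @` Om) `*` (@to_rV R d @` Om),
    continuous (fun p : 'rV[R]_d * 'rV[R]_d => Phi (of_rV p.1) (of_rV p.2))} ->
  step_approximable Om Phi.
Proof.
move=> Phi_cont e e0.
have [r r0 hr] := compact_uniform_modulus
  (compact_setX Om_compact Om_compact) Phi_cont e0.
have [N [x [Ox xO]]] := finite_net r0.
(* Removing the cubes of smaller index makes the pieces disjoint: a point of [Om] lies only in the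
   piece of the first cube containing it. *)
pose C k := cube (x k) r `\` \big[setU/set0]_(l < N | (l < k)%N) cube (x l) r.
have C_part u : Om u -> exists2 k, cube (x k) r u &
    forall l, \1_(C l) u = (l == k)%:R :> R.
  move=> /xO[k0 k0u].
  have Pk0 : `[< cube (x k0) r u >] by exact/asboolP.
  have [k /asboolP ku k_min] := @arg_minnP _ k0 (fun k => `[< cube (x k) r u >])
    (fun k : 'I_N => k : nat) Pk0.
  exists k => // l; rewrite indicE; congr (_%:R); congr (nat_of_bool _).
  apply/idP/eqP => [/set_mem|->]; last first.
    apply: mem_set; split=> //; rewrite -bigcup_seq_cond.
    move=> [j /= /andP[_ jk] /asboolP /k_min].
    by rewrite leqNgt jk.
  move=> -[/asboolP /k_min kl nlu]; apply/val_inj/eqP.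
  rewrite eqn_leq kl andbT leqNgt; apply/negP => kl'; apply: nlu.
  by rewrite -bigcup_seq_cond; exists k => //=; rewrite mem_index_enum.
exists N, x, C; split=> // [k|u v Ou Ov].
  by apply: measurableD => //; exact: bigsetU_measurable.
have [[k ku uC] [l lv vC]] := (C_part u Ou, C_part v Ov).
(* Only one term of the step kernel survives at [(u, v)], and its centres are within [r] of [u] and
   [v]. *)
have -> : \sum_i \sum_j Phi (x i) (x j) * \1_(C i) u * \1_(C j) v = Phi (x k) (x l).
  rewrite (bigD1 k)//= [X in _ + X = _]big1 ?addr0; last first.
    by move=> i ik; rewrite big1// => j _; rewrite uC (negPf ik) mulr0 mul0r.
  rewrite (bigD1 l)//= [X in _ + X = _]big1 ?addr0; last first.
    by move=> j jl; rewrite vC (negPf jl) mulr0.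
  by rewrite uC vC !eqxx !mulr1.
rewrite distrC.
have := hr (to_rV (x k), to_rV (x l)) (to_rV u, to_rV v); rewrite /= !to_rVK.
apply; first by split; [exists (x k)|exists (x l)].
  by split; [exists u|exists v].
by split.
Qed.

End euclidean.

(** * The matrix of kernel averages *)

Lemma posdef_mx_unit (R : realType) n (K : 'M[R]_n) : posdef_mx K -> K \in unitmx.
Proof.
move=> K_pos; rewrite unitmxE unitfE; apply/det0P => -[v v0 vK].
have := K_pos v^T; rewrite trmxK vK mul0mx mxE ltxx => /(_ _)/eqP.
by rewrite -trmx0 (inj_eq trmx_inj) v0 => /(_ isT).
Qed.

Section average_matrix.
Context (dT : measure_display) (T : measurableType dT) (R : realType).
Variables (nu : {measure set T -> \bar R}) (Om : set T) (Phi : T -> T -> R).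
Variables (n : nat) (om : 'I_n -> set T).
Hypothesis mOm : measurable Om.
Hypothesis Om_fin : (nu Om < +oo)%E.
Hypothesis Phi_sym : forall x y, Om x -> Om y -> Phi x y = Phi y x.
Hypothesis Phi_pos : posdef_kernel Om Phi.
Hypothesis Phi_step : step_approximable Om Phi.
Hypothesis mom : forall i, measurable (om i).
Hypothesis omOm : forall i, om i `<=` Om.

Let K : 'M[R]_n := \matrix_(i < n, j < n)
  ((fine (nu (om i)))^-1 * (fine (nu (om j)))^-1 *
   Rintegral nu (om i) (fun x => Rintegral nu (om j) (fun y => Phi x y))).

(** Not normalised: the factors [1 / |om i|] stay outside, in [KE] and in the coefficients [a i]
    below. *)
Let avg i (f : T -> R) := Rintegral nu Om (fun x => \1_(om i) x * f x).

Let avg_bounded i : bounded_functional Om (avg i).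
Proof.
apply: functional_mul_bounded; first exact: bounded_mfun_indic.
exact: integral_bounded_functional.
Qed.

Let KE i j : K i j = (fine (nu (om i)))^-1 * (fine (nu (om j)))^-1 *
  avg i (fun x => avg j (Phi x)).
Proof.
rewrite mxE (Rintegral_sub_indic _ _ (@omOm i)); congr (_ * Rintegral _ _ _).
by apply/funext => x; rewrite (Rintegral_sub_indic _ _ (@omOm j)).
Qed.

(** The two integrals are exchanged by [functional2C], applied to [avg i] and [avg j]. *)
Lemma average_matrix_sym : K^T = K.
Proof.
apply/matrixP => i j; rewrite mxE !KE (functional2C Phi_sym Phi_step)//.
by rewrite [(fine _)^-1 * _]mulrC.
Qed.

Hypothesis Phi_dense : native_dense_L2 nu Om Phi.
Hypothesis om_gt0 : forall i, (0 < nu (om i))%E.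
Hypothesis om_free : forall c : 'I_n -> R,
  {ae nu, forall x, Om x -> \sum_(i < n) c i * \1_(om i) x = 0} ->
  forall i, c i = 0.

Lemma average_matrix_posdef : posdef_mx K.
Proof.
(* Absorbing the measures into the coefficients turns the quadratic form of [K] into [L] applied
   twice to [Phi]. *)
move=> v v0; pose a i := v i 0 / fine (nu (om i)).
pose L f := \sum_i a i * avg i f.
have bL : bounded_functional Om L by exact: functional_sum_bounded.
pose g x := \sum_i a i * \1_(om i) x.
have bom i : bounded_mfun Om (\1_(om i) : T -> R) by exact: bounded_mfun_indic.
have bg : bounded_mfun Om g.
  by apply: bounded_mfun_sum => i; exact: bounded_mfunZ.
have bI := integral_bounded_functional mOm Om_fin.
have LE f : bounded_mfun Om f -> L f = Rintegral nu Om (fun x => g x * f x).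
  move=> bf; under eq_Rintegral do rewrite mulr_suml.
  rewrite (functional_sum bI); last first.
    by move=> i; apply: bounded_mfunM => //; exact: bounded_mfunZ.
  apply: eq_bigr => i _; under [RHS]eq_Rintegral do rewrite -mulrA.
  by rewrite (functionalZ bI)//; exact: bounded_mfunM.
have -> : (v^T *m K *m v) 0 0 = L (fun x => L (Phi x)).
  rewrite mxE.
  transitivity (\sum_i a i * \sum_j a j * avg i (fun x => avg j (Phi x))).
    under eq_bigr do rewrite mxE mulr_suml.
    rewrite exchange_big/=; apply: eq_bigr => i _; rewrite mulr_sumr.
    by apply: eq_bigr => j _; rewrite [v^T 0 i]mxE KE /a; ring.
  apply: eq_bigr => i _; congr (_ * _).
  rewrite (functional_sum (avg_bounded i)).
    apply: eq_bigr => j _; rewrite (functionalZ (avg_bounded i))//.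
    exact: bounded_mfun_functional.
  by move=> j; apply: bounded_mfunZ; exact: bounded_mfun_functional.
(* Semidefiniteness is known, so it remains to show that a vanishing form forces [v = 0]. *)
rewrite lt_neqAle (functional2_ge0 Phi_pos Phi_step bL) andbT eq_sym.
apply: contra_neq v0 => LL0.
have a0 : forall i, a i = 0.
  apply: om_free; apply: (ae_eq0_of_kernel_form_eq0 Phi_sym Phi_pos Phi_step) => //.
  rewrite -[RHS]LL0 [RHS]LE; last exact: bounded_mfun_functional.
  apply: (functional_eq bI).
  - apply: bounded_mfunM => //.
    exact: (bounded_mfun_functional Phi_step (functional_mul_bounded bg bI)).
  - apply: bounded_mfunM => //; exact: bounded_mfun_functional.
  - by move=> x Ox; rewrite LE//; exact: bounded_mfun_kernel.
apply/colP => i; rewrite mxE; have /eqP := a0 i.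
rewrite mulf_eq0 invr_eq0 => /orP[/eqP//|].
(* [fine] sends infinity to 0, so a nonzero denominator takes both positive and finite measure;
   finiteness comes from [Om]. *)
rewrite fine_eq0 ?gt_eqF// ge0_fin_numE// (le_lt_trans _ Om_fin)//.
by apply: le_measure (@omOm i); exact: mem_set.
Qed.

End average_matrix.

Unset Implicit Arguments.

Theorem theorem5p3 (R : realType) (d : nat)
    (mu : {measure set (d.-tuple R) -> \bar R})
    (Om : set (LebT mu)) (Phi : LebT mu -> LebT mu -> R)
    (n : nat) (om : 'I_n -> set (LebT mu)) :
  is_box_volume mu ->
  compact (@to_rV R d @` Om) ->
  {within (@to_rV R d @` Om) `*` (@to_rV R d @` Om),
    continuous (fun p : 'rV[R]_d * 'rV[R]_d => Phi (of_rV p.1) (of_rV p.2))} ->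
  (forall x y, Om x -> Om y -> Phi x y = Phi y x) ->
  posdef_kernel Om Phi ->
  native_dense_L2 (leb mu) Om Phi ->
  (forall i, measurable (om i)) ->
  (forall i, om i `<=` Om) ->
  (forall i, (0 < leb mu (om i))%E) ->
  (forall c : 'I_n -> R,
     {ae leb mu, forall x, Om x -> \sum_(i < n) c i * \1_(om i) x = 0} ->
     forall i, c i = 0) ->
  let K := \matrix_(i < n, j < n)
      ((fine (leb mu (om i)))^-1 * (fine (leb mu (om j)))^-1 *
       Rintegral (leb mu) (om i)
         (fun x => Rintegral (leb mu) (om j) (fun y => Phi x y))) in
  K^T = K /\ posdef_mx K /\ K \in unitmx.
Proof.
move=> mu_box Om_compact Phi_cont Phi_sym Phi_pos Phi_dense mom omOm om_gt0 om_free K.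
(* Compactness and continuity enter only through the next three facts. *)
have mOm := compact_LebT_measurable Om_compact.
have Om_fin := compact_LebT_fin Om_compact mu_box.
have Phi_step := continuous_step_approximable Om_compact Phi_cont.
have K_pos : posdef_mx K by exact: (@average_matrix_posdef _ _ _ _ Om).
split; first exact: (@average_matrix_sym _ _ _ _ Om).
by split => //; exact: posdef_mx_unit.
Qed.
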